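(* Let $K$ be a field of characteristic not $2$ or $3$ and let $(A,*,\alpha)$ be a multiplicative right Hom-alternative superalgebra over $K$. For homogeneous $x,y,z\in A$ put $$[x,y]:=\tfrac12\big(x*y-(-1)^{\bar x\bar y}y*x\big),\qquad x\circ y:=\tfrac12\big(x*y+(-1)^{\bar x\bar y}y*x\big),$$ $$\{x,y,z\}:=(-1)^{\bar x(\bar y+\bar z)}\big((y\circ z)\circ\alpha(x)-\alpha(y)\circ(z\circ x)\big),$$ extended (bi-, tri-)linearly to $A$. Then the supercommutator Hom-algebra $(A,[\cdot,\cdot],\alpha)$, equipped with the ternary operation $\{\cdot,\cdot,\cdot\}$, is a Hom-Bol superalgebra; that is, $(A,[\cdot,\cdot],\{\cdot,\cdot,\cdot\},\alpha)$ is a Hom-Bol superalgebra.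
   Context: A superspace is a $\mathbb{Z}_2$-graded vector space $A=A_0\oplus A_1$; an element $x\in A_i$ is homogeneous of degree $\bar x=i$. A linear map $f:A\to A$ is even if $f(A_i)\subset A_i$ for $i=0,1$. A multiplicative (binary) Hom-superalgebra $(A,*,\alpha)$ consists of a superspace $A$, a bilinear product $*$ with $A_i*A_j\subset A_{i+j}$, and an even linear map $\alpha:A\to A$ with $\alpha(x*y)=\alpha(x)*\alpha(y)$; $\alpha$ is not assumed injective or surjective. With the Hom-associator $as_\alpha(x,y,z):=(x*y)*\alpha(z)-\alpha(x)*(y*z)$, it is right Hom-alternative if $as_\alpha(x,y,z)=-(-1)^{\bar y\bar z}as_\alpha(x,z,y)$ for all homogeneous $x,y,z\in A$. A Hom-Bol superalgebra is a quadruple $(A,[\cdot,\cdot],\{\cdot,\cdot,\cdot\},\alpha)$ where $A$ is a superspace, $[\cdot,\cdot]$ is a bilinear and $\{\cdot,\cdot,\cdot\}$ a trilinear operation on $A$, both compatible with the grading ($[A_i,A_j]\subset A_{i+j}$, $\{A_i,A_j,A_k\}\subset A_{i+j+k}$), and $\alpha:A\to A$ is an even linear map, such that for all homogeneous $u,v,w,x,y,z\in A$: (1) $\alpha([x,y])=[\alpha(x),\alpha(y)]$; (2) $\alpha(\{x,y,z\})=\{\alpha(x),\alpha(y),\alpha(z)\}$; (3) $[x,y]=-(-1)^{\bar x\bar y}[y,x]$; (4) $\{x,y,z\}=-(-1)^{\bar x\bar y}\{y,x,z\}$; (5) $\{x,y,z\}+(-1)^{\bar x(\bar y+\bar z)}\{y,z,x\}+(-1)^{\bar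 z(\bar x+\bar y)}\{z,x,y\}=0$; (6) $\{\alpha(x),\alpha(y),[u,v]\}=[\{x,y,u\},\alpha^2(v)]+(-1)^{\bar u(\bar x+\bar y)}[\alpha^2(u),\{x,y,v\}]+(-1)^{(\bar x+\bar y)(\bar u+\bar v)}\big(\{\alpha(u),\alpha(v),[x,y]\}-[[\alpha(u),\alpha(v)],[\alpha(x),\alpha(y)]]\big)$; (7) $\{\alpha^2(x),\alpha^2(y),\{u,v,w\}\}=\{\{x,y,u\},\alpha^2(v),\alpha^2(w)\}+(-1)^{\bar u(\bar x+\bar y)}\{\alpha^2(u),\{x,y,v\},\alpha^2(w)\}+(-1)^{(\bar x+\bar y)(\bar u+\bar v)}\{\alpha^2(u),\alpha^2(v),\{x,y,w\}\}$. *)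

(* Defs.v *)
From HB Require Import structures.
From mathcomp Require Import all_boot all_order all_algebra.

Set Implicit Arguments.
Unset Strict Implicit.
Unset Printing Implicit Defensive.

Import GRing.Theory.
Local Open Scope ring_scope.

(* Parities are booleans: [i (+) j] is addition in Z/2, and exponents of -1
   are computed in nat through the coercion bool >-> nat. *)
Record superspace (K : fieldType) := Superspace {
  carrier :> lmodType K;
  homog : bool -> {pred carrier};
  homog_submod : forall i, submod_closed (homog i);
  homog_span : forall x : carrier,
    exists x0, (x0 \in homog false) && (x - x0 \in homog true);
  homog_direct : forall x,
    x \in homog false -> x \in homog true -> x = 0
}.

Arguments homog {K} A i : rename.
Arguments homog_submod {K} A i : rename.
Arguments homog_span {K} A x : rename.

Section Superspaces.

Variables (K : fieldType) (A : superspace K).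

Definition part (i : bool) (x : A) : A :=
  let x0 := xchoose (homog_span A x) in if i then x - x0 else x0.

Lemma part_homog i x : part i x \in homog A i.
Proof.
by rewrite /part; case: i; have /andP[] := xchooseP (homog_span A x).
Qed.

Lemma part_sum x : part false x + part true x = x.
Proof. by rewrite /part addrC subrK. Qed.

Lemma homogB i x y :
  x \in homog A i -> y \in homog A i -> x - y \in homog A i.
Proof.
move=> xi yi; have [_ lin] := homog_submod A i.
by rewrite addrC -scaleN1r; apply: lin.
Qed.

Lemma part_unique x x0 x1 :
  x0 \in homog A false -> x1 \in homog A true -> x = x0 + x1 ->
  part false x = x0 /\ part true x = x1.
Proof.
move=> x00 x11 def_x.
have eq_p: part false x - x0 = x1 - part true x.
  apply/eqP; rewrite subr_eq addrAC eq_sym subr_eq part_sum def_x.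
  by rewrite addrC.
have p0: part false x - x0 = 0.
  apply: homog_direct; first exact: homogB (part_homog _ _) x00.
  by rewrite eq_p; apply: homogB x11 (part_homog _ _).
split; apply/eqP; first by rewrite -subr_eq0 p0.
by rewrite eq_sym -subr_eq0 -eq_p p0.
Qed.

Lemma part_id i x : x \in homog A i -> part i x = x.
Proof.
move=> xi; have z j : 0 \in homog A j by have [] := homog_submod A j.
case: i xi => xi.
  by have [] := part_unique (z false) xi (esym (add0r x)).
by have [] := part_unique xi (z true) (esym (addr0 x)).
Qed.

Lemma part_neg i x : x \in homog A i -> part (~~ i) x = 0.
Proof.
move=> xi; have z j : 0 \in homog A j by have [] := homog_submod A j.
case: i xi => xi.
  by have [] := part_unique (z false) xi (esym (add0r x)).
by have [] := part_unique xi (z true) (esym (addr0 x)).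
Qed.

Definition trilinear (t : A -> A -> A -> A) :=
  [/\ forall y z, linear (fun x => t x y z),
      forall x z, linear (fun y => t x y z)
    & forall x y, linear (fun z => t x y z)].

Definition even_map (f : A -> A) :=
  forall i x, x \in homog A i -> f x \in homog A i.

Definition graded2 (m : A -> A -> A) :=
  forall i j x y, x \in homog A i -> y \in homog A j ->
    m x y \in homog A (i (+) j).

Definition graded3 (t : A -> A -> A -> A) :=
  forall i j k x y z,
    x \in homog A i -> y \in homog A j -> z \in homog A k ->
    t x y z \in homog A (i (+) j (+) k).

Definition mult_Hom_superalgebra (mul : A -> A -> A) (alpha : A -> A) :=
  [/\ bilinear_for *:%R *:%R mul, graded2 mul, linear alpha, even_map alpha
    & forall x y, alpha (mul x y) = mul (alpha x) (alpha y)].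

Definition Hom_associator (mul : A -> A -> A) (alpha : A -> A) (x y z : A) :=
  mul (mul x y) (alpha z) - mul (alpha x) (mul y z).

Definition right_Hom_alternative (mul : A -> A -> A) (alpha : A -> A) :=
  forall (i j k : bool) (x y z : A),
    x \in homog A i -> y \in homog A j -> z \in homog A k ->
    Hom_associator mul alpha x y z
      = - ((-1) ^+ (j * k)%N *: Hom_associator mul alpha x z y).

(* Given formulas [f i j x y] for [x], [y] homogeneous of degrees [i], [j],
   biadditive in [x], [y], this is their extension to A; likewise [extend3]. *)
Definition extend2 (f : bool -> bool -> A -> A -> A) (x y : A) : A :=
  \sum_(i : bool) \sum_(j : bool) f i j (part i x) (part j y).

Definition extend3 (f : bool -> bool -> bool -> A -> A -> A -> A)
    (x y z : A) : A :=
  \sum_(i : bool) \sum_(j : bool) \sum_(k : bool)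
    f i j k (part i x) (part j y) (part k z).

Definition supercommutator (mul : A -> A -> A) : A -> A -> A :=
  extend2 (fun i j x y =>
    2^-1 *: (mul x y - (-1) ^+ (i * j)%N *: mul y x)).

Definition superjordan (mul : A -> A -> A) : A -> A -> A :=
  extend2 (fun i j x y =>
    2^-1 *: (mul x y + (-1) ^+ (i * j)%N *: mul y x)).

Definition supertriple (mul : A -> A -> A) (alpha : A -> A) :
    A -> A -> A -> A :=
  let jor := superjordan mul in
  extend3 (fun i j k x y z =>
    (-1) ^+ (i * (j + k))%N *:
      (jor (jor y z) (alpha x) - jor (alpha y) (jor z x))).

Record Hom_Bol_superalgebra (br : A -> A -> A) (tr : A -> A -> A -> A)
    (alpha : A -> A) : Prop := HomBolSuperalgebra {
  Bol_br_bilinear : bilinear_for *:%R *:%R br;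
  Bol_br_graded : graded2 br;
  Bol_tr_trilinear : trilinear tr;
  Bol_tr_graded : graded3 tr;
  Bol_alpha_linear : linear alpha;
  Bol_alpha_even : even_map alpha;
  Bol_alpha_br : forall i j x y, x \in homog A i -> y \in homog A j ->
    alpha (br x y) = br (alpha x) (alpha y);
  Bol_alpha_tr : forall i j k x y z,
    x \in homog A i -> y \in homog A j -> z \in homog A k ->
    alpha (tr x y z) = tr (alpha x) (alpha y) (alpha z);
  Bol_br_skew : forall (i j : bool) x y, x \in homog A i -> y \in homog A j ->
    br x y = - ((-1) ^+ (i * j)%N *: br y x);
  Bol_tr_skew : forall (i j k : bool) x y z,
    x \in homog A i -> y \in homog A j -> z \in homog A k ->
    tr x y z = - ((-1) ^+ (i * j)%N *: tr y x z);
  Bol_tr_cyclic : forall (i j k : bool) x y z,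
    x \in homog A i -> y \in homog A j -> z \in homog A k ->
    tr x y z + (-1) ^+ (i * (j + k))%N *: tr y z x
      + (-1) ^+ (k * (i + j))%N *: tr z x y = 0;
  Bol_tr_br : forall (i j k l : bool) x y u v,
    x \in homog A i -> y \in homog A j ->
    u \in homog A k -> v \in homog A l ->
    tr (alpha x) (alpha y) (br u v)
      = br (tr x y u) (alpha (alpha v))
        + (-1) ^+ (k * (i + j))%N *: br (alpha (alpha u)) (tr x y v)
        + (-1) ^+ ((i + j) * (k + l))%N *:
            (tr (alpha u) (alpha v) (br x y)
             - br (br (alpha u) (alpha v)) (br (alpha x) (alpha y)));
  Bol_tr_tr : forall (i j k l m : bool) x y u v w,
    x \in homog A i -> y \in homog A j ->
    u \in homog A k -> v \in homog A l -> w \in homog A m ->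
    tr (alpha (alpha x)) (alpha (alpha y)) (tr u v w)
      = tr (tr x y u) (alpha (alpha v)) (alpha (alpha w))
        + (-1) ^+ (k * (i + j))%N *:
            tr (alpha (alpha u)) (tr x y v) (alpha (alpha w))
        + (-1) ^+ ((i + j) * (k + l))%N *:
            tr (alpha (alpha u)) (alpha (alpha v)) (tr x y w)
}.

End Superspaces.

Lemma big_parity (K : fieldType) (A : superspace K) (F : bool -> A) (i : bool) :
  F (~~ i) = 0 -> \sum_(j : bool) F j = F i.
Proof. by rewrite big_bool; case: i => /= ->; rewrite ?addr0 ?add0r. Qed.

Section Homogeneous.

Variables (K : fieldType) (A : superspace K) (mul : A -> A -> A).
Hypothesis mul_bilin : bilinear_for *:%R *:%R mul.

Let mul0x y : mul 0 y = 0.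
Proof. by have := mul_bilin.1 y (-1) 0 0; rewrite /= scaler0 addr0 scaleN1r addNr. Qed.

Let mulx0 x : mul x 0 = 0.
Proof. by have := mul_bilin.2 x (-1) 0 0; rewrite /= scaler0 addr0 scaleN1r addNr. Qed.

Lemma supercommutatorE (i j : bool) (x y : A) :
  x \in homog A i -> y \in homog A j ->
  supercommutator mul x y = 2^-1 *: (mul x y - (-1) ^+ (i * j)%N *: mul y x).
Proof.
move=> xi yj; rewrite /supercommutator /extend2 (big_parity (i := i)).
  rewrite (big_parity (i := j)) ?(part_id xi) ?(part_id yj) //.
  by rewrite (part_neg yj) mul0x mulx0 scaler0 subr0 scaler0.
by apply: big1 => k _; rewrite (part_neg xi) mul0x mulx0 scaler0 subr0 scaler0.
Qed.

Lemma superjordanE (i j : bool) (x y : A) :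
  x \in homog A i -> y \in homog A j ->
  superjordan mul x y = 2^-1 *: (mul x y + (-1) ^+ (i * j)%N *: mul y x).
Proof.
move=> xi yj; rewrite /superjordan /extend2 (big_parity (i := i)).
  rewrite (big_parity (i := j)) ?(part_id xi) ?(part_id yj) //.
  by rewrite (part_neg yj) mul0x mulx0 scaler0 addr0 scaler0.
by apply: big1 => k _; rewrite (part_neg xi) mul0x mulx0 scaler0 addr0 scaler0.
Qed.

Let part0 i : part i (0 : A) = 0.
Proof. by apply: part_id; have [] := homog_submod A i. Qed.

Let jor0x y : superjordan mul 0 y = 0.
Proof.
apply: big1 => i _; apply: big1 => j _.
by rewrite part0 mul0x mulx0 scaler0 addr0 scaler0.
Qed.

Let jorx0 x : superjordan mul x 0 = 0.
Proof.
apply: big1 => i _; apply: big1 => j _.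
by rewrite part0 mul0x mulx0 scaler0 addr0 scaler0.
Qed.

Variable alpha : A -> A.
Hypothesis alpha_lin : linear alpha.

Let alpha0 : alpha 0 = 0.
Proof. by have := alpha_lin (-1) 0 0; rewrite /= scaler0 addr0 scaleN1r addNr. Qed.

Lemma supertripleE (i j k : bool) (x y z : A) :
  x \in homog A i -> y \in homog A j -> z \in homog A k ->
  supertriple mul alpha x y z = (-1) ^+ (i * (j + k))%N *:
    (superjordan mul (superjordan mul y z) (alpha x)
     - superjordan mul (alpha y) (superjordan mul z x)).
Proof.
move=> xi yj zk; rewrite /supertriple /extend3 (big_parity (i := i)).
  rewrite (big_parity (i := j)).
    rewrite (big_parity (i := k)) ?(part_id xi) ?(part_id yj) ?(part_id zk) //.
    by rewrite (part_neg zk) jorx0 !jor0x jorx0 subr0 scaler0.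
  apply: big1 => k' _.
  by rewrite (part_neg yj) alpha0 !jor0x subr0 scaler0.
apply: big1 => j' _; apply: big1 => k' _.
by rewrite (part_neg xi) alpha0 !jorx0 subr0 scaler0.
Qed.

End Homogeneous.

(* Main.v *)
(* Write R_a for the right multiplication by a, with operators acting on the
   right.  Linearised right alternativity says that R sends the Jordan product
   x o y to (R_x R_y + R_y R_x) / 2, up to signs and twists, so R sends
   4 {x,y,z} to [R_z, [R_y, R_x]], and 4 {x,y,z} itself is the corresponding sum
   of left-normed products.  Both sides of the two Bol identities thus become
   signed sums of left-normed products (and, for the binary identity, of
   products of two commutators), and these sums coincide formally.  The twists
   never obstruct this since every monomial carries the largest power of alpha
   that its degree allows. *)

Require Import Defs.
From mathcomp Require Import all_boot all_order all_algebra.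

Set Implicit Arguments.
Unset Strict Implicit.
Unset Printing Implicit Defensive.

Import GRing.Theory.
Local Open Scope ring_scope.

(** * Reflective comparison of signed sums of vectors *)

Inductive signed_sum :=
  | SZero
  | SAtom of nat
  | SAdd of signed_sum & signed_sum
  | SOpp of signed_sum
  | SSign of nat & signed_sum.

Fixpoint coef_signed_sum (e : signed_sum) (a : nat) : int :=
  match e with
  | SZero => 0
  | SAtom b => (b == a)%:Z
  | SAdd e1 e2 => coef_signed_sum e1 a + coef_signed_sum e2 a
  | SOpp e1 => - coef_signed_sum e1 a
  | SSign n e1 =>
      if odd n then - coef_signed_sum e1 a else coef_signed_sum e1 a
  end.

Definition coefs_signed_sum (n : nat) (e : signed_sum) : seq int :=
  [seq coef_signed_sum e a | a <- iota 0%N n].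

Section SignedSums.

Variables (K : fieldType) (V : lmodType K).

Fixpoint eval_signed_sum (s : seq V) (e : signed_sum) : V :=
  match e with
  | SZero => 0
  | SAtom a => s`_a
  | SAdd e1 e2 => eval_signed_sum s e1 + eval_signed_sum s e2
  | SOpp e1 => - eval_signed_sum s e1
  | SSign n e1 => (-1) ^+ n *: eval_signed_sum s e1
  end.

Lemma eval_signed_sumE s e :
  eval_signed_sum s e = \sum_(a < size s) s`_a *~ coef_signed_sum e a.
Proof.
elim: e => [|b|e1 IH1 e2 IH2|e1 IH|n e1 IH] /=.
- by rewrite big1 // => a _; rewrite mulr0z.
- have [ltb|leb] := ltnP b (size s).
    rewrite (bigD1 (Ordinal ltb)) //= eqxx big1 ?addr0 // => a.
    by rewrite -val_eqE /= eq_sym => /negPf->.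
  (* An index beyond the end of [s] denotes the default vector 0, and its coefficient meets no term
     of the sum. *)
  rewrite nth_default // big1 // => a _.
  by rewrite gtn_eqF // (leq_trans _ leb).
- by rewrite IH1 IH2 -big_split; apply: eq_bigr => a _; rewrite mulrzDr.
- by rewrite IH -sumrN; apply: eq_bigr => a _; rewrite mulrNz.
- rewrite IH -signr_odd; case: odd; last by rewrite scale1r.
  by rewrite scaleN1r -sumrN; apply: eq_bigr => a _; rewrite mulrNz.
Qed.

(** A sufficient test only: the atoms are treated as independent, so equal integer coefficients give
    an equality in any module. *)
Lemma eq_signed_sum s e1 e2 :
  coefs_signed_sum (size s) e1 = coefs_signed_sum (size s) e2 ->
  eval_signed_sum s e1 = eval_signed_sum s e2.
Proof.
move=> eq_e; rewrite !eval_signed_sumE; apply: eq_bigr => a _.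
have a_in: (val a < size (iota 0%N (size s)))%N by rewrite size_iota ltn_ord.
have := congr1 (fun t => nth 0 t a) eq_e.
by rewrite !(nth_map 0%N) // nth_iota // => ->.
Qed.

End SignedSums.

Ltac atom_index x s :=
  lazymatch s with
  | x :: _ => constr:(0%N)
  | _ :: ?t => let n := atom_index x t in constr:(S n)
  end.

(** The backtracking [match] is essential: [atom_index] fails when [x] is not yet listed, and only
    then is the second branch tried. *)
Ltac add_atom x s :=
  match s with
  | _ => let n := atom_index x s in s
  | _ => constr:(x :: s)
  end.

(** New atoms go in front and shift the indices, so the atoms of both sides are collected before
    either side is reified. *)
Ltac atoms_of x s :=
  lazymatch x with
  | 0 => s
  | ?y + ?z => let t := atoms_of y s in atoms_of z t
  | - ?y => atoms_of y s
  | (-1) ^+ _ *: ?y => atoms_of y s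
  | _ => add_atom x s
  end.

Ltac reify_sum x s :=
  lazymatch x with
  | 0 => constr:(SZero)
  | ?y + ?z =>
      let e1 := reify_sum y s in let e2 := reify_sum z s in
      constr:(SAdd e1 e2)
  | - ?y => let e := reify_sum y s in constr:(SOpp e)
  | (-1) ^+ ?n *: ?y => let e := reify_sum y s in constr:(SSign n e)
  | _ => let n := atom_index x s in constr:(SAtom n)
  end.

(* The exponents of -1 stay symbolic in the reified sums, so the goal that is
   left is decided by computation once the parities are known. *)
Ltac compare_coefs :=
  lazymatch goal with
  | |- @eq ?T ?x ?y =>
      let s0 := atoms_of x (@nil T) in
      let s := atoms_of y s0 in
      let e1 := reify_sum x s in
      let e2 := reify_sum y s in
      apply: (@eq_signed_sum _ _ s e1 e2)
  end.

(** * Homogeneous components and multilinear extension *)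

Section SuperspaceLinearity.

Variables (K : fieldType) (A : superspace K).

Lemma homogZ i c (x : A) : x \in homog A i -> c *: x \in homog A i.
Proof.
by move=> xi; have [z0 lin] := homog_submod A i; rewrite -[_ *: x]addr0 lin.
Qed.

Lemma homogN i (x : A) : x \in homog A i -> - x \in homog A i.
Proof. by move=> xi; rewrite -scaleN1r homogZ. Qed.

Lemma homogD i (x y : A) :
  x \in homog A i -> y \in homog A i -> x + y \in homog A i.
Proof. by move=> xi yi; rewrite -[y]opprK homogB // homogN. Qed.

Lemma scaler_swap a b (x : A) : a *: (b *: x) = b *: (a *: x).
Proof. by rewrite !scalerA mulrC. Qed.

(** As [part] rests on a choice, linearity comes from the uniqueness of the decomposition into
    homogeneous components. *)
Lemma part_linear i : linear (@part K A i).
Proof.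
move=> c x y; have [eq0 eq1] : part false (c *: x + y)
    = c *: part false x + part false y
  /\ part true (c *: x + y) = c *: part true x + part true y.
  apply: part_unique.
  - by apply: homogD; first apply: homogZ; exact: part_homog.
  - by apply: homogD; first apply: homogZ; exact: part_homog.
  - by rewrite addrACA -scalerDr !part_sum.
by case: i.
Qed.

Lemma extend2_bilinear f :
  (forall i j, bilinear_for *:%R *:%R (f i j)) ->
  bilinear_for *:%R *:%R (@extend2 K A f).
Proof.
move=> f_lin; split=> z c x y; rewrite /extend2 /= scaler_sumr -big_split;
  apply: eq_bigr => i _; rewrite scaler_sumr -big_split;
  apply: eq_bigr => j _; rewrite part_linear.
- exact: (f_lin i j).1.
- exact: (f_lin i j).2.
Qed.

Lemma extend3_trilinear f :
  (forall i j k, trilinear (f i j k)) -> trilinear (@extend3 K A f).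
Proof.
move=> f_lin; split=> z z' c x y; rewrite /extend3 scaler_sumr -big_split;
  apply: eq_bigr => i _; rewrite scaler_sumr -big_split;
  apply: eq_bigr => j _; rewrite scaler_sumr -big_split;
  apply: eq_bigr => k _; rewrite part_linear; have [f1 f2 f3] := f_lin i j k;
  by [exact: f1 | exact: f2 | exact: f3].
Qed.

Lemma linear_scale a (f : A -> A) : linear f -> linear (fun x => a *: f x).
Proof. by move=> fl c x y; rewrite fl scalerDr !scalerA mulrC. Qed.

Lemma linear_add (f g : A -> A) :
  linear f -> linear g -> linear (fun x => f x + g x).
Proof. by move=> fl gl c x y; rewrite fl gl scalerDr addrACA. Qed.

Lemma linear_sub (f g : A -> A) :
  linear f -> linear g -> linear (fun x => f x - g x).
Proof. by move=> fl gl c x y; rewrite fl gl scalerBr opprD addrACA. Qed.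

Lemma linear_comp (f g : A -> A) :
  linear f -> linear g -> linear (fun x => f (g x)).
Proof. by move=> fl gl c x y; rewrite gl fl. Qed.

End SuperspaceLinearity.

(** * Left-normed expansions in a right Hom-alternative superalgebra *)

Section RightHomAlternative.

Variables (K : fieldType) (A : superspace K).
Variables (mul : A -> A -> A) (alpha : A -> A).
Hypothesis A_Hom : mult_Hom_superalgebra mul alpha.
Hypothesis A_alt : right_Hom_alternative mul alpha.

Let mul_bilin : bilinear_for *:%R *:%R mul. Proof. by case: A_Hom. Qed.
Let alpha_lin : linear alpha. Proof. by case: A_Hom. Qed.
Let mul_homog : graded2 mul. Proof. by case: A_Hom. Qed.
Let alpha_homog : even_map alpha. Proof. by case: A_Hom. Qed.
Let alphaM x y : alpha (mul x y) = mul (alpha x) (alpha y).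
Proof. by case: A_Hom. Qed.

Let mulDl x y z : mul (x + y) z = mul x z + mul y z.
Proof. by have := mul_bilin.1 z 1 x y; rewrite /= !scale1r. Qed.
Let mul0l z : mul 0 z = 0.
Proof. by apply: (addIr (mul 0 z)); rewrite -mulDl !add0r. Qed.
Let mulZl c x z : mul (c *: x) z = c *: mul x z.
Proof. by have := mul_bilin.1 z c x 0; rewrite /= mul0l !addr0. Qed.
Let mulNl x z : mul (- x) z = - mul x z.
Proof. by rewrite -scaleN1r mulZl scaleN1r. Qed.
Let mulDr z x y : mul z (x + y) = mul z x + mul z y.
Proof. by have := mul_bilin.2 z 1 x y; rewrite /= !scale1r. Qed.
Let mul0r z : mul z 0 = 0.
Proof. by apply: (addIr (mul z 0)); rewrite -mulDr !add0r. Qed.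
Let mulZr c z x : mul z (c *: x) = c *: mul z x.
Proof. by have := mul_bilin.2 z c x 0; rewrite /= mul0r !addr0. Qed.
Let mulNr z x : mul z (- x) = - mul z x.
Proof. by rewrite -scaleN1r mulZr scaleN1r. Qed.
Let alphaD x y : alpha (x + y) = alpha x + alpha y.
Proof. by have := alpha_lin 1 x y; rewrite !scale1r. Qed.
Let alpha0 : alpha 0 = 0.
Proof. by apply: (addIr (alpha 0)); rewrite -alphaD !add0r. Qed.
Let alphaZ c x : alpha (c *: x) = c *: alpha x.
Proof. by have := alpha_lin c x 0; rewrite alpha0 !addr0. Qed.
Let alphaN x : alpha (- x) = - alpha x.
Proof. by rewrite -scaleN1r alphaZ scaleN1r. Qed.

(** Pushes [mul] through sums and [alpha] down to the generators, so that equal monomials become the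
    same atom for [compare_coefs]. *)
Let distr :=
  (mulDl, mulDr, mulNl, mulNr, mulZl, mulZr, alphaD, alphaN, alphaZ, alphaM).

(** Twice the Jordan product, with explicit parities: this keeps 1/2 and the projections [part] out
    of the computations. *)
Definition jordan2 (i j : bool) (x y : A) : A :=
  mul x y + (-1) ^+ (i * j)%N *: mul y x.

Lemma mul_jordan2 (j k : bool) (p y z : A) :
  y \in homog A j -> z \in homog A k ->
  mul (alpha p) (jordan2 j k y z)
    = mul (mul p y) (alpha z) + (-1) ^+ (j * k)%N *: mul (mul p z) (alpha y).
Proof.
(* No sign involves the degree of [p], so it suffices to treat its two homogeneous parts and add. *)
move=> yj zk; rewrite /jordan2 -[p]part_sum.
move: (part false p) (part true p) (part_homog false p) (part_homog true p).
move=> p0 p1 p0_even p1_odd; rewrite !distr.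
have /eqP := A_alt p0_even yj zk; have /eqP := A_alt p1_odd yj zk.
rewrite /Hom_associator !subr_eq => /eqP-> /eqP->; rewrite !scalerDr !scalerN.
by compare_coefs; case: j k {yj zk} => -[].
Qed.

Definition comm2 (i j : bool) (x y : A) : A :=
  mul x y - (-1) ^+ (i * j)%N *: mul y x.

(* Up to signs, 4 {x,y,z} is the sum of the left-normed products that would be
   1 * [R_z, [R_y, R_x]] if A were unital, R being the right multiplication. *)
Definition triple4 (i j k : bool) (x y z : A) : A :=
  mul (comm2 i j x y) (alpha z)
    - (-1) ^+ (k * (i + j))%N *:
        (mul (mul z x) (alpha y)
         - (-1) ^+ (i * j)%N *: mul (mul z y) (alpha x)).

Lemma comm2E (i j : bool) (x y : A) :
  x \in homog A i -> y \in homog A j ->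
  supercommutator mul x y = 2^-1 *: comm2 i j x y.
Proof. exact: supercommutatorE. Qed.

Lemma jordan2E (i j : bool) (x y : A) :
  x \in homog A i -> y \in homog A j ->
  superjordan mul x y = 2^-1 *: jordan2 i j x y.
Proof. exact: superjordanE. Qed.

Lemma jordan2Zl (i j : bool) c (x y : A) :
  jordan2 i j (c *: x) y = c *: jordan2 i j x y.
Proof. by rewrite /jordan2 mulZl mulZr scalerDr !scalerA mulrC. Qed.

Lemma jordan2Zr (i j : bool) c (x y : A) :
  jordan2 i j x (c *: y) = c *: jordan2 i j x y.
Proof. by rewrite /jordan2 mulZl mulZr scalerDr !scalerA mulrC. Qed.

Lemma jordan2_homog (i j : bool) (x y : A) :
  x \in homog A i -> y \in homog A j -> jordan2 i j x y \in homog A (i (+) j).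
Proof.
move=> xi yj; apply: homogD; first exact: mul_homog.
by rewrite addbC; apply/homogZ/mul_homog.
Qed.

Lemma alpha_jordan2 (i j : bool) (x y : A) :
  alpha (jordan2 i j x y) = jordan2 i j (alpha x) (alpha y).
Proof. by rewrite /jordan2 !distr. Qed.

(** Once [mul_jordan2] has made all eight monomials left-normed, the two copies of [(y*z)*alpha(x)]
    cancel, as do those of [(x*z)*alpha(y)]. *)
Lemma triple4_jordan2 (i j k : bool) (x y z : A) :
  x \in homog A i -> y \in homog A j -> z \in homog A k ->
  triple4 i j k x y z = (-1) ^+ (i * (j + k))%N *:
    (jordan2 (j (+) k) i (jordan2 j k y z) (alpha x)
     - jordan2 j (k (+) i) (alpha y) (jordan2 k i z x)).
Proof.
move=> xi yj zk.
(* Only the outer Jordan products are unfolded: [mul_jordan2] needs the inner ones intact. *)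
rewrite {1}/jordan2 (mul_jordan2 _ yj zk) {2}/jordan2 (mul_jordan2 _ zk xi).
rewrite /triple4 /comm2 /jordan2 !distr.
by compare_coefs; case: i j k {xi yj zk} => -[] [].
Qed.

(** Each of the two nested Jordan products contributes a factor 1/2. *)
Lemma supertriple4E (i j k : bool) (x y z : A) :
  x \in homog A i -> y \in homog A j -> z \in homog A k ->
  supertriple mul alpha x y z = (2^-1 * 2^-1) *: triple4 i j k x y z.
Proof.
move=> xi yj zk; rewrite (supertripleE mul_bilin alpha_lin xi yj zk).
rewrite (triple4_jordan2 xi yj zk) (jordan2E yj zk) (jordan2E zk xi).
have jyz := jordan2_homog yj zk; have jzx := jordan2_homog zk xi.
rewrite (jordan2E (homogZ _ jyz) (alpha_homog xi)).
rewrite (jordan2E (alpha_homog yj) (homogZ _ jzx)).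
rewrite scalerA mulrC -scalerA; congr (_ *: _).
by rewrite jordan2Zl jordan2Zr -!scalerBr scalerA.
Qed.

(** Operator form of the associative identity by which the Jordan associator of y, z, x is 1/4
    [z,[y,x]], up to signs. *)
Lemma mul_triple4 (i j k : bool) (p x y z : A) :
  x \in homog A i -> y \in homog A j -> z \in homog A k ->
  mul (alpha (alpha p)) (triple4 i j k x y z)
    = mul (mul (mul p x) (alpha y)
             - (-1) ^+ (i * j)%N *: mul (mul p y) (alpha x))
          (alpha (alpha z))
      - (-1) ^+ (k * (i + j))%N *:
          (mul (mul (mul p z) (alpha x)) (alpha (alpha y))
           - (-1) ^+ (i * j)%N *:
               mul (mul (mul p z) (alpha y)) (alpha (alpha x))).
Proof.
move=> xi yj zk; rewrite (triple4_jordan2 xi yj zk) mulZr mulDr mulNr.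
have [axi ayj azk] := And3 (alpha_homog xi) (alpha_homog yj) (alpha_homog zk).
rewrite (mul_jordan2 _ (jordan2_homog yj zk) axi).
(* Folding [alpha p * alpha x] into [alpha (p * x)] provides the twisted left factor for the second
   use of [mul_jordan2]. *)
rewrite (mul_jordan2 _ ayj (jordan2_homog zk xi)) !alpha_jordan2 -!alphaM.
rewrite (mul_jordan2 _ yj zk) (mul_jordan2 _ zk xi).
rewrite !(mul_jordan2 _ ayj azk, mul_jordan2 _ azk axi) !distr.
by compare_coefs; case: i j k {xi yj zk axi ayj azk} => -[] [].
Qed.

(** * The two Bol identities, freed of denominators *)

Lemma alpha_comm2 (i j : bool) (x y : A) :
  alpha (comm2 i j x y) = comm2 i j (alpha x) (alpha y).
Proof. by rewrite /comm2 !distr. Qed.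

(** Besides left-normed monomials there are products of commutators: up to twists, the last term
    removes the [[u,v]*[x,y]] of the preceding triple and supplies the [[x,y]*[u,v]] found on the
    left. *)
Lemma triple4_comm2 (i j k l : bool) (x y u v : A) :
  x \in homog A i -> y \in homog A j -> u \in homog A k -> v \in homog A l ->
  triple4 i j (k (+) l) (alpha x) (alpha y) (comm2 k l u v)
    = comm2 (i (+) j (+) k) l (triple4 i j k x y u) (alpha (alpha v))
      + (-1) ^+ (k * (i + j))%N *:
          comm2 k (i (+) j (+) l) (alpha (alpha u)) (triple4 i j l x y v)
      + (-1) ^+ ((i + j) * (k + l))%N *:
          (triple4 k l (i (+) j) (alpha u) (alpha v) (comm2 i j x y)
           - comm2 (k (+) l) (i (+) j) (comm2 k l (alpha u) (alpha v))
               (comm2 i j (alpha x) (alpha y))).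
Proof.
move=> xi yj uk vl; rewrite ![comm2 _ _ (triple4 _ _ _ _ _ _) _]/comm2.
rewrite ![comm2 _ _ _ (triple4 _ _ _ _ _ _)]/comm2.
rewrite (mul_triple4 _ xi yj uk) (mul_triple4 _ xi yj vl).
rewrite /triple4 /comm2 !distr.
by compare_coefs; case: i j k l {xi yj uk vl} => -[] [] [].
Qed.

Lemma alpha_triple4 (i j k : bool) (x y z : A) :
  alpha (triple4 i j k x y z) = triple4 i j k (alpha x) (alpha y) (alpha z).
Proof. by rewrite /triple4 /comm2 !distr. Qed.

(** On right multiplications the triple is a double commutator, and bracketing with [[R_y,R_x]] is a
    superderivation. *)
Lemma triple4_triple4 (i j k l m : bool) (x y u v w : A) :
  x \in homog A i -> y \in homog A j -> u \in homog A k ->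
  v \in homog A l -> w \in homog A m ->
  triple4 i j (k (+) l (+) m) (alpha (alpha x)) (alpha (alpha y))
      (triple4 k l m u v w)
    = triple4 (i (+) j (+) k) l m
        (triple4 i j k x y u) (alpha (alpha v)) (alpha (alpha w))
      + (-1) ^+ (k * (i + j))%N *: triple4 k (i (+) j (+) l) m
          (alpha (alpha u)) (triple4 i j l x y v) (alpha (alpha w))
      + (-1) ^+ ((i + j) * (k + l))%N *: triple4 k l (i (+) j (+) m)
          (alpha (alpha u)) (alpha (alpha v)) (triple4 i j m x y w).
Proof.
move=> xi yj uk vl wm.
(* The names shield the inner triples while the outer ones are unfolded, so that [mul_triple4] still
   finds them as right factors. *)
set t := triple4 k l m u v w; set tu := triple4 i j k x y u.
set tv := triple4 i j l x y v; set tw := triple4 i j m x y w.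
rewrite /triple4 /comm2 !(mulDl, mulNl, mulZl).
(* [alpha] moves into the triples but out of the products, which yields the doubly twisted left
   factors [mul_triple4] expects. *)
rewrite /t /tu /tv /tw !alpha_triple4 -!alphaM.
rewrite !(mul_triple4 _ xi yj uk, mul_triple4 _ xi yj vl).
have [axi ayj] := conj (alpha_homog xi) (alpha_homog yj).
have [auk avl awm] := And3 (alpha_homog uk) (alpha_homog vl) (alpha_homog wm).
rewrite !(mul_triple4 _ auk avl awm, mul_triple4 _ axi ayj auk).
rewrite !(mul_triple4 _ axi ayj avl, mul_triple4 _ axi ayj awm).
rewrite /triple4 /comm2 !distr.
clear xi yj uk vl wm axi ayj auk avl awm t tu tv tw.
by compare_coefs; case: i j k l m => -[] [] [] [].
Qed.

(** * Linearity, grading and symmetries of the operations *)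

Lemma supercommutator_bilinear :
  bilinear_for *:%R *:%R (supercommutator mul).
Proof.
have [ml mr] := mul_bilin.
apply: extend2_bilinear => i j; split=> z /=; apply: linear_scale;
  apply: linear_sub; try apply: linear_scale; by [apply: ml | apply: mr].
Qed.

Lemma superjordan_bilinear : bilinear_for *:%R *:%R (superjordan mul).
Proof.
have [ml mr] := mul_bilin.
apply: extend2_bilinear => i j; split=> z /=; apply: linear_scale;
  apply: linear_add; try apply: linear_scale; by [apply: ml | apply: mr].
Qed.

Lemma supertriple_trilinear : trilinear (supertriple mul alpha).
Proof.
set J := superjordan mul; have [JL JR] := superjordan_bilinear.
have Jl w : linear (fun x => J x w) := JL w.
have Jr w : linear (J w) := JR w.
apply: extend3_trilinear => i j k; split=> z z'; apply: linear_scale.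
- apply: linear_sub.
    exact: linear_comp (Jr (J z z')) alpha_lin.
  exact: linear_comp (Jr (alpha z)) (Jr z').
- apply: linear_sub.
    exact: linear_comp (Jl (alpha z)) (Jl z').
  exact: linear_comp (Jl (J z' z)) alpha_lin.
- apply: linear_sub.
    exact: linear_comp (Jl (alpha z)) (Jr z').
  exact: linear_comp (Jr (alpha z')) (Jl z).
Qed.

Lemma comm2_homog (i j : bool) (x y : A) :
  x \in homog A i -> y \in homog A j -> comm2 i j x y \in homog A (i (+) j).
Proof.
move=> xi yj; apply: homogB; first exact: mul_homog.
by rewrite addbC; apply/homogZ/mul_homog.
Qed.

Lemma triple4_homog (i j k : bool) (x y z : A) :
  x \in homog A i -> y \in homog A j -> z \in homog A k ->
  triple4 i j k x y z \in homog A (i (+) j (+) k).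
Proof.
move=> xi yj zk.
have [axi ayj azk] := And3 (alpha_homog xi) (alpha_homog yj) (alpha_homog zk).
apply: homogB; first exact: mul_homog (comm2_homog xi yj) azk.
apply/homogZ/homogB; last apply: homogZ.
  by rewrite addbC addbA; apply: mul_homog ayj; apply: mul_homog.
by rewrite -addbA addbC (addbC j); apply: mul_homog axi; apply: mul_homog.
Qed.

Lemma comm2Zl (i j : bool) c (x y : A) :
  comm2 i j (c *: x) y = c *: comm2 i j x y.
Proof. by rewrite /comm2 mulZl mulZr scalerBr !scalerA mulrC. Qed.

Lemma comm2Zr (i j : bool) c (x y : A) :
  comm2 i j x (c *: y) = c *: comm2 i j x y.
Proof. by rewrite /comm2 mulZl mulZr scalerBr !scalerA mulrC. Qed.

Lemma triple4Zl (i j k : bool) c (x y z : A) :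
  triple4 i j k (c *: x) y z = c *: triple4 i j k x y z.
Proof.
rewrite /triple4 comm2Zl alphaZ !(mulZl, mulZr).
by rewrite !scalerBr ![_ *: (c *: _)]scaler_swap.
Qed.

Lemma triple4Zm (i j k : bool) c (x y z : A) :
  triple4 i j k x (c *: y) z = c *: triple4 i j k x y z.
Proof.
rewrite /triple4 comm2Zr alphaZ !(mulZl, mulZr).
by rewrite !scalerBr ![_ *: (c *: _)]scaler_swap.
Qed.

Lemma triple4Zr (i j k : bool) c (x y z : A) :
  triple4 i j k x y (c *: z) = c *: triple4 i j k x y z.
Proof.
rewrite /triple4 alphaZ !(mulZl, mulZr).
by rewrite !scalerBr ![_ *: (c *: _)]scaler_swap.
Qed.

Lemma comm2_skew (i j : bool) (x y : A) :
  comm2 i j x y = - ((-1) ^+ (i * j)%N *: comm2 j i y x).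
Proof. by rewrite /comm2; compare_coefs; case: i j => -[]. Qed.

Lemma triple4_skew (i j k : bool) (x y z : A) :
  triple4 i j k x y z = - ((-1) ^+ (i * j)%N *: triple4 j i k y x z).
Proof.
by rewrite /triple4 /comm2 !distr; compare_coefs; case: i j k => -[] [].
Qed.

(** The super Jacobi identity for double commutators: each of the six monomials [(a*b)*alpha(c)]
    occurs twice, with opposite signs. *)
Lemma triple4_cyclic (i j k : bool) (x y z : A) :
  triple4 i j k x y z + (-1) ^+ (i * (j + k))%N *: triple4 j k i y z x
    + (-1) ^+ (k * (i + j))%N *: triple4 k i j z x y = 0.
Proof.
by rewrite /triple4 /comm2 !distr; compare_coefs; case: i j k => -[] [].
Qed.

(** The identities for [comm2] and [triple4] transfer because all terms scale alike: by 1/8 in the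
    binary Bol identity, by 1/16 in the ternary one. *)
Lemma supercommutator_Hom_Bol :
  Hom_Bol_superalgebra (supercommutator mul) (supertriple mul alpha) alpha.
Proof.
split=> //.
- exact: supercommutator_bilinear.
- by move=> i j x y xi yj; rewrite (comm2E xi yj) homogZ ?comm2_homog.
- exact: supertriple_trilinear.
- move=> i j k x y z xi yj zk.
  by rewrite (supertriple4E xi yj zk) homogZ ?triple4_homog.
- move=> i j x y xi yj; rewrite (comm2E xi yj) alphaZ alpha_comm2.
  by rewrite (comm2E (alpha_homog xi) (alpha_homog yj)).
- move=> i j k x y z xi yj zk; rewrite (supertriple4E xi yj zk) alphaZ.
  rewrite alpha_triple4.
  by rewrite (supertriple4E (alpha_homog xi) (alpha_homog yj) (alpha_homog zk)).
- move=> i j x y xi yj; rewrite (comm2E xi yj) (comm2E yj xi).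
  by rewrite comm2_skew scalerN scaler_swap.
- move=> i j k x y z xi yj zk.
  rewrite (supertriple4E xi yj zk) (supertriple4E yj xi zk).
  by rewrite triple4_skew scalerN scaler_swap.
- move=> i j k x y z xi yj zk.
  rewrite (supertriple4E xi yj zk) (supertriple4E yj zk xi).
  rewrite (supertriple4E zk xi yj) ![(-1) ^+ _ *: (_ *: _)]scaler_swap.
  by rewrite -!scalerDr triple4_cyclic scaler0.
- move=> i j k l x y u v xi yj uk vl.
  have [axi ayj] := conj (alpha_homog xi) (alpha_homog yj).
  have [auk avl] := conj (alpha_homog uk) (alpha_homog vl).
  have [cxy cuv] := conj (comm2_homog xi yj) (comm2_homog uk vl).
  have [caxy cauv] := conj (comm2_homog axi ayj) (comm2_homog auk avl).
  have [txyu txyv] := conj (triple4_homog xi yj uk) (triple4_homog xi yj vl).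
  rewrite (comm2E uk vl) (comm2E xi yj) (comm2E auk avl) (comm2E axi ayj).
  rewrite (supertriple4E xi yj uk) (supertriple4E xi yj vl).
  rewrite (supertriple4E axi ayj (homogZ _ cuv)).
  rewrite (supertriple4E auk avl (homogZ _ cxy)).
  rewrite (comm2E (homogZ _ txyu) (alpha_homog avl)).
  rewrite (comm2E (alpha_homog auk) (homogZ _ txyv)).
  rewrite (comm2E (homogZ _ cauv) (homogZ _ caxy)).
  rewrite !(triple4Zr, comm2Zl, comm2Zr) (triple4_comm2 xi yj uk vl).
  (* Splitting each 1/4 into two scalings by 1/2 makes the common factor 1/8 look the same in every
     term, the nested commutator included. *)
  rewrite -!scalerA -!scalerBr ![(-1) ^+ _ *: (2^-1 *: _)]scaler_swap.
  by rewrite -!scalerDr.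
- move=> i j k l m x y u v w xi yj uk vl wm.
  have aaxi := alpha_homog (alpha_homog xi).
  have aayj := alpha_homog (alpha_homog yj).
  have aauk := alpha_homog (alpha_homog uk).
  have aavl := alpha_homog (alpha_homog vl).
  have aawm := alpha_homog (alpha_homog wm).
  have tuvw := triple4_homog uk vl wm; have txyu := triple4_homog xi yj uk.
  have txyv := triple4_homog xi yj vl; have txyw := triple4_homog xi yj wm.
  rewrite (supertriple4E uk vl wm) (supertriple4E xi yj uk).
  rewrite (supertriple4E xi yj vl) (supertriple4E xi yj wm).
  rewrite (supertriple4E aaxi aayj (homogZ _ tuvw)).
  rewrite (supertriple4E (homogZ _ txyu) aavl aawm).
  rewrite (supertriple4E aauk (homogZ _ txyv) aawm).
  rewrite (supertriple4E aauk aavl (homogZ _ txyw)).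
  rewrite !(triple4Zl, triple4Zm, triple4Zr) (triple4_triple4 xi yj uk vl wm).
  by rewrite ![(-1) ^+ _ *: (2^-1 * _ *: _)]scaler_swap -!scalerDr.
Qed.

End RightHomAlternative.

Theorem theorem5p1 (K : fieldType) (A : superspace K)
    (mul : A -> A -> A) (alpha : A -> A)
    (char_not2 : 2%N \notin [pchar K]) (char_not3 : 3%N \notin [pchar K])
    (A_Hom : mult_Hom_superalgebra mul alpha)
    (A_alt : right_Hom_alternative mul alpha) :
  Hom_Bol_superalgebra (supercommutator mul) (supertriple mul alpha) alpha.
Proof.
exact: supercommutator_Hom_Bol.
Qed.
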